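(* Let $k\ge 1$ and let $1,2,\dots,k$ be distinct vertices. Let $s$ be a graph with no edge containing the vertex $1$. Let $(12\cdots k)$ denote the edge on the vertices $1,\dots,k$ and $(2\cdots k)$ the edge on the vertices $2,\dots,k$. Then for $n\in\mathbb{N}$: (1) $s\wedge(12\cdots k)\;\sim\; s$; (2) $s\wedge(12\cdots k)^n\;\sim\; s\wedge(2\cdots k)^{\lfloor n/2\rfloor}$ if $1<n<2^k$; (3) $s\wedge(12\cdots k)^n\;\sim\;\{\bot\}$ (i.e. $s\wedge(12\cdots k)^n$ is unsatisfiable) if $n\ge 2^k$.
   Context: Boolean formulae. Fix a countable set of variables. A clause is a disjunction of one or more literals (variables, negated variables, or constants $\top,\bot$), viewed as a set of literals. A Cnf is a conjunction of one or more clauses, viewed as a set of clauses. A Cnf is satisfiable if some truth assignment makes it true. Graphs. Each vertex $v$ is also a boolean variable. An edge is a nonempty set of vertices, written by juxtaposition; a graph is a nonempty multiset of edges, written $(e_1)^{n_1}\cdots(e_m)^{n_m}$ with $n_i$ the multiplicity of $e_i$. Graphs as sets of Cnfs. The edge $v_1\cdots v_k$ supports the $2^k$ clauses $l_1\vee\cdots\vee l_k$ with $l_i\in\{v_i,\overline{v_i}\}$. The edge $e$ with multiplicity $n$, written $(e)^n$, corresponds to the set of all Cnfs $c_1\wedge\cdots\wedge c_n$ with $c_1,\dots,c_n$ pairwise distinct clauses supported on $e$ (empty if $n>2^{|e|}$). A graph $(e_1)^{n_1}\cdots(e_m)^{n_m}$ is identified with the set of all Cnfs $x_1\wedge\cdots\wedge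 x_m$ with $x_i$ in the set corresponding to $(e_i)^{n_i}$. For sets of Cnfs, $s_1\wedge s_2=\{x_1\wedge x_2: x_1\in s_1,x_2\in s_2\}$. A set of Cnfs is totally satisfiable if it is nonempty and every Cnf in it is satisfiable; otherwise it is unsatisfiable. $s_1\sim s_2$ (equi-satisfiable) means both are totally satisfiable or both are unsatisfiable. *)

(* Defs.v *)
From HB Require Import structures.
From mathcomp Require Import all_boot.
From mathcomp Require Import finmap multiset.
From mathcomp Require Import classical_sets.

Set Implicit Arguments.
Unset Strict Implicit.
Unset Printing Implicit Defensive.

Local Open Scope fset_scope.
Local Open Scope classical_set_scope.

Record nefset (K : choiceType) := NEFset {
  nefset_val :> {fset K};
  nefset_proof : nefset_val != fset0 }.

HB.instance Definition _ (K : choiceType) :=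
  [isSub for @nefset_val K].
HB.instance Definition _ (K : choiceType) :=
  [Choice of nefset K by <:].

Lemma nefsetU_proof (K : choiceType) (A B : nefset K) : (A `|` B)%fset != fset0.
Proof. by rewrite fsetU_eq0 negb_and (nefset_proof A). Qed.

Definition nefsetU (K : choiceType) (A B : nefset K) : nefset K :=
  NEFset (nefsetU_proof A B).

Lemma nefset1_proof (K : choiceType) (a : K) : [fset a]%fset != fset0.
Proof. by apply/fset0Pn; exists a; rewrite in_fset1. Qed.

Definition nefset1 (K : choiceType) (a : K) : nefset K :=
  NEFset (nefset1_proof a).

Section Formulae.
Variable V : countType.

Inductive literal := Var of V | NegVar of V | Top | Bot.

Definition literal_code (l : literal) : V + V + bool :=
  match l with
  | Var v => inl (inl v)
  | NegVar v => inl (inr v)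
  | Top => inr true
  | Bot => inr false
  end.

Definition literal_decode (t : V + V + bool) : literal :=
  match t with
  | inl (inl v) => Var v
  | inl (inr v) => NegVar v
  | inr b => if b then Top else Bot
  end.

Lemma literal_codeK : cancel literal_code literal_decode.
Proof. by case. Qed.

HB.instance Definition _ := Countable.copy literal (can_type literal_codeK).

Definition clause := nefset literal.
Definition cnf := nefset clause.

Definition assignment := V -> bool.

Definition eval_literal (a : assignment) (l : literal) : bool :=
  match l with
  | Var v => a v
  | NegVar v => ~~ a v
  | Top => true
  | Bot => false
  end.

Definition eval_clause (a : assignment) (c : clause) : bool :=
  has (eval_literal a) (c : {fset literal}).

Definition eval_cnf (a : assignment) (x : cnf) : bool :=
  all (eval_clause a) (x : {fset clause}).

Definition satisfiable (x : cnf) : Prop := exists a : assignment, eval_cnf a x.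

Definition cnf_bot : cnf := nefset1 (nefset1 Bot : clause).

Definition totally_satisfiable (s : set cnf) : Prop :=
  s !=set0 /\ forall x, s x -> satisfiable x.

Definition unsatisfiable (s : set cnf) : Prop := ~ totally_satisfiable s.

Definition equisat (s1 s2 : set cnf) : Prop :=
  (totally_satisfiable s1 /\ totally_satisfiable s2) \/
  (unsatisfiable s1 /\ unsatisfiable s2).

Definition set_and (s1 s2 : set cnf) : set cnf :=
  [set nefsetU x1 x2 | x1 in s1 & x2 in s2].

Definition supports (e : {fset V}) (c : clause) : Prop :=
  exists sgn : V -> bool,
    c = [fset (if sgn v then Var v else NegVar v) | v in e]%fset :> {fset literal}.

(* Since a Cnf has at least one clause, [edge_pow e 0] is empty; only positive
   exponents are meaningful. *)
Definition edge_pow (e : {fset V}) (n : nat) : set cnf :=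
  [set x : cnf | exists c : n.-tuple clause,
     [/\ uniq c, forall i, supports e (tnth c i)
       & x = [fset d | d in tval c]%fset :> {fset clause}]].

(* Edges are plain finite sets, so that the edge on the vertices 2, ..., k can
   be written even for k = 1; nonemptiness is imposed in graphs. *)
Record graph := Graph {
  graph_edges : {mset {fset V}}%mset;
  graph_neq0 : graph_edges != mset0;
  graph_edge_neq0 : fset0 \notin graph_edges }.

(* [finsupp (graph_edges g)] lists the distinct edges e_1, ..., e_m of [g], and
   [graph_edges g e] is the multiplicity of [e]. *)
Definition graph_cnfs (g : graph) : set cnf :=
  [set x : cnf | exists f : {fset V} -> cnf,
     (forall e, e \in finsupp (graph_edges g) ->
        edge_pow e (graph_edges g e) (f e)) /\
     x = (\bigcup_(e <- finsupp (graph_edges g)) (f e : {fset clause}))%fset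
       :> {fset clause}].

Definition edge_from_to (v : nat -> V) (i j : nat) : {fset V} :=
  [fset x | x in [seq v l | l <- index_iota i j.+1]]%fset.

End Formulae.

(* Main.v *)
Require Import Defs.
From mathcomp Require Import all_boot.
From mathcomp Require Import finmap multiset.
From mathcomp Require Import classical_sets boolp.

(** Write [u] for the vertex 1 and [e] for the edge
    2...k, so that 1...k is [u |` e].  A clause supported on an edge is falsified
    by exactly one sign pattern of that edge, and [edge_pow e n] is the family of
    [n]-element subsets of the [2 ^ #|` e|] supported clauses ([edge_pow_sub]).
    For [0 < n <= 2 ^ #|` e|], every choice of at most [n] supported clauses
    therefore extends to a member of [edge_pow e n] ([edge_pow_between]).

    A clause on [u |` e] is a literal of [u] added to a clause on [e] ([or_lit],
    [supports_or_lit], [supports_or_lit_inv]), in a unique way ([or_lit_inj]).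
    Since no clause of [s] mentions [u], the value of [u] can be changed without
    affecting [s] ([graph_cnfs_ignores]).

    A single clause on an edge through [u] is then satisfied by choosing [u]
    alone ([edge_single_equisat]), while all [2 ^ k] clauses together leave no
    assignment ([edge_full_unsat]).

    For [n] in between, one implication of the equivalence doubles and the other
    halves.  If [m = n %/ 2] clauses on [e] are given, disjoining each of them
    with [u] and with its negation gives [2 m <= n] clauses on [u |` e]; whatever
    the value of [u], satisfying them all forces the given ones
    ([edge_double_sat]).  Conversely, among [n] clauses on [u |` e], one of the
    two signs of [u] occurs at most [m] times.  Choosing [u] to satisfy every
    clause with the other sign, there remain at most [m] clauses on [e], and these
    can be completed to exactly [m] ([edge_half_sat]). *)

Set Implicit Arguments.
Unset Strict Implicit.
Unset Printing Implicit Defensive.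

Local Open Scope fset_scope.

(** * Finite sets and halving *)

Lemma fsubset_intermediate (K : choiceType) (A B : {fset K}) (m : nat) :
  A `<=` B -> #|` A| <= m <= #|` B| ->
  exists C : {fset K}, [/\ A `<=` C, C `<=` B & #|` C| = m].
Proof.
move=> sAB /andP[]; elim: m => [|m IHm].
  by rewrite leqn0 => /eqP A0 _; exists A.
rewrite leq_eqVlt => /predU1P[<- _|ltAm ltmB]; first by exists A.
have [C [sAC sCB cC]] := IHm ltAm (ltnW ltmB).
have /fsubsetPn[x xB xC] : ~~ (B `<=` C).
  by apply/negP => /fsubset_leq_card; rewrite cC leqNgt ltmB.
exists (x |` C); split.
- exact: fsubset_trans sAC (fsubsetUr _ _).
- by rewrite fsubUset fsub1set xB.
- by rewrite cardfsU1 xC cC.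
Qed.

Lemma half_le_exp2 n k : n <= 2 ^ k.+1 -> n %/ 2 <= 2 ^ k.
Proof. by move=> le_n; rewrite -(@mulnK (2 ^ k) 2) // leq_div2r // -expnSr. Qed.

(** * Clauses supported on an edge *)

Section Clauses.
Variable V : countType.
Implicit Types (u w : V) (e : {fset V}) (a : assignment V) (c d : clause V)
  (x y : cnf V).

Definition lit (b : bool) (w : V) : literal V := if b then Var w else NegVar w.

Lemma eval_lit a b w : eval_literal a (lit b w) = (a w == b).
Proof. by case: b => /=; case: (a w). Qed.

Lemma lit_inj b1 b2 w1 w2 : lit b1 w1 = lit b2 w2 -> b1 = b2 /\ w1 = w2.
Proof. by case: b1; case: b2 => // -[->]. Qed.

Lemma eval_clauseP a c :
  reflect (exists2 l, l \in nefset_val c & eval_literal a l) (eval_clause a c).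
Proof. exact: hasP. Qed.

Lemma eval_cnfP a x :
  reflect (forall c, c \in nefset_val x -> eval_clause a c) (eval_cnf a x).
Proof. exact: allP. Qed.

Lemma eval_cnfU a x y :
  eval_cnf a (nefsetU x y) = eval_cnf a x && eval_cnf a y.
Proof.
apply/eval_cnfP/andP => [H|[/eval_cnfP Hx /eval_cnfP Hy] c].
  by split; apply/eval_cnfP => c cx; apply: H; rewrite /= in_fsetU cx ?orbT.
by rewrite /= in_fsetU => /orP[/Hx|/Hy].
Qed.

Lemma signed_clause_proof (e : nefset V) (sgn : V -> bool) :
  [fset lit (sgn w) w | w in nefset_val e] != fset0.
Proof.
have /fset0Pn[w we] := nefset_proof e.
by apply/fset0Pn; exists (lit (sgn w) w); apply/imfsetP; exists w.
Qed.

Definition signed_clause (e : nefset V) (sgn : V -> bool) : clause V :=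
  NEFset (signed_clause_proof e sgn).

Lemma supports_signed (e : nefset V) sgn : supports e (signed_clause e sgn).
Proof. by exists sgn. Qed.

Lemma supportsP (e : nefset V) c :
  supports e c <-> exists sgn, c = signed_clause e sgn.
Proof.
by split=> [[sgn cE]|[sgn ->]]; exists sgn => //; apply: val_inj.
Qed.

Lemma supports_mem e c l :
  supports e c -> l \in nefset_val c ->
  exists b, exists2 w, w \in e & l = lit b w.
Proof.
by case=> sgn -> /imfsetP[w /= we ->]; exists (sgn w), w.
Qed.

Lemma eq_eval_clause e c a1 a2 :
  supports e c -> {in e, a1 =1 a2} -> eval_clause a1 c = eval_clause a2 c.
Proof.
move=> ec eq_a; apply/eval_clauseP/eval_clauseP => -[l lc al];
  exists l => //; have [b [w we lE]] := supports_mem ec lc;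
  by move: al; rewrite lE !eval_lit eq_a.
Qed.

(** A sign pattern on [e] matters only through the subset of [e] where it is
    positive, so indexing by the powerset of [e] lists each clause once. *)
Definition clauses_on (e : nefset V) : {fset clause V} :=
  [fset signed_clause e (fun w => w \in A)
     | A : {fset V} in fpowerset (nefset_val e)].

Lemma clauses_onP (e : nefset V) c : reflect (supports e c) (c \in clauses_on e).
Proof.
rewrite /clauses_on; apply: (iffP (imfsetP _ _ _ _)) => [[A _ ->]|].
  exact: supports_signed.
case/supportsP => sgn ->; exists [fset w in nefset_val e | sgn w].
  by rewrite /= fpowersetE; apply/fsubsetP => w; rewrite !inE => /andP[].
apply: val_inj => /=; apply: eq_in_imfset => // w we.
by rewrite !inE we.
Qed.

Lemma card_clauses_on (e : nefset V) : #|` clauses_on e| = 2 ^ #|` e|.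
Proof.
rewrite card_in_imfset ?card_fpowerset //= => A B.
rewrite !fpowersetE => sA sB /(congr1 (@nefset_val _))/= eqAB.
have signP w : w \in nefset_val e -> (w \in A) = (w \in B).
  move=> we; have : lit (w \in A) w \in
      [fset lit (w \in A) w | w in nefset_val e] by apply/imfsetP; exists w.
  by rewrite eqAB => /imfsetP[w' _ /lit_inj[-> ->]].
apply/fsetP => w; apply/idP/idP => wAB.
  by rewrite -signP // (fsubsetP sA).
by rewrite signP // (fsubsetP sB).
Qed.

(** Replaces the tuple of distinct clauses by the resulting set: a Cnf of an edge
    power is determined by its clauses, whose order is immaterial. *)
Lemma edge_powP e n x :
  edge_pow e n x <->
  #|` x| = n /\ (forall c, c \in nefset_val x -> supports e c).
Proof.
split=> [[t [t_uniq t_supp xE]]|[cardx x_supp]].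
  rewrite xE card_fseq undup_id // size_tuple; split=> // c.
  by rewrite inE => /tnthP[i ->].
have szx : size (nefset_val x) == n by rewrite -cardx.
exists (Tuple szx); split=> [|i|].
- exact: fset_uniq.
- by apply: x_supp; apply: mem_tnth.
- by apply/fsetP => c; rewrite inE.
Qed.

Lemma edge_pow_sub (e : nefset V) n x :
  edge_pow e n x <-> #|` x| = n /\ nefset_val x `<=` clauses_on e.
Proof.
rewrite edge_powP; split=> -[cardx H]; split=> //.
  by apply/fsubsetP => c /H/clauses_onP.
by move=> c /(fsubsetP H)/clauses_onP.
Qed.

(** The hypotheses of total satisfiability speak of Cnfs with a prescribed number
    of clauses, whereas halving and doubling produce only some of these clauses;
    satisfying a larger Cnf satisfies the part that matters. *)
Lemma edge_pow_between (e : nefset V) n (A : {fset clause V}) :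
  A `<=` clauses_on e -> #|` A| <= n <= 2 ^ #|` e| -> 0 < n ->
  exists2 x, edge_pow e n x & A `<=` nefset_val x.
Proof.
rewrite -card_clauses_on => sA An n_gt0.
have [C [sAC sCe cC]] := fsubset_intermediate sA An.
have C0 : C != fset0 by rewrite -cardfs_gt0 cC.
by exists (NEFset C0) => //; apply/edge_pow_sub.
Qed.

Lemma edge_pow_inhabited (e : nefset V) n :
  0 < n <= 2 ^ #|` e| -> exists x, edge_pow e n x.
Proof.
case/andP=> n_gt0 le_n.
have [||//|x ex _] := @edge_pow_between e n fset0; first exact: fsub0set.
  by rewrite cardfs0.
by exists x.
Qed.

(** The Cnf must contain all supported clauses, among them the one made of the
    literals that the given assignment falsifies. *)
Lemma edge_pow_full_unsat (e : nefset V) n x :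
  2 ^ #|` e| <= n -> edge_pow e n x -> ~ satisfiable x.
Proof.
move=> le_n /edge_pow_sub[cardx sxe] [a /eval_cnfP ax].
have /eqP xE : nefset_val x == clauses_on e.
  by rewrite eqEfcard sxe card_clauses_on cardx.
have /ax/eval_clauseP[l /imfsetP[w _ ->]] :
    signed_clause e (fun w => ~~ a w) \in nefset_val x.
  by rewrite xE; apply/clauses_onP/supports_signed.
by rewrite eval_lit; case: (a w).
Qed.

(** * Adding a vertex to an edge *)

Definition or_lit u b c : clause V := nefsetU (nefset1 (lit b u)) c.

Lemma eval_or_lit a u b c :
  eval_clause a (or_lit u b c) = (a u == b) || eval_clause a c.
Proof.
rewrite -eval_lit; apply/eval_clauseP/orP => [[l]|[al|/eval_clauseP[l lc al]]].
- rewrite !inE => /orP[/eqP->|lc] al; first by left.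
  by right; apply/eval_clauseP; exists l.
- by exists (lit b u) => //; rewrite !inE eqxx.
- by exists l => //; rewrite !inE lc orbT.
Qed.

Lemma supports_or_lit u b e c :
  u \notin e -> supports e c -> supports (u |` e) (or_lit u b c).
Proof.
move=> ue [sgn cE]; exists [eta sgn with u |-> b].
rewrite imfsetU1 /= eqxx cE; congr (_ |` _).
apply: eq_in_imfset => // w we; case: eqP => // wu.
by move: ue; rewrite -wu we.
Qed.

Lemma supports_or_lit_inv u (e : nefset V) c :
  u \notin nefset_val e -> supports (u |` nefset_val e) c ->
  exists b, exists2 d, supports e d & c = or_lit u b d.
Proof.
move=> ue [sgn cE]; exists (sgn u), (signed_clause e sgn).
  exact: supports_signed.
by apply: val_inj; rewrite /= cE imfsetU1.
Qed.

Lemma lit_notin_supported u b e c :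
  u \notin e -> supports e c -> lit b u \notin nefset_val c.
Proof.
move=> ue ec; apply/negP => /(supports_mem ec)[b' [w we]] /lit_inj[_ uw].
by move: ue; rewrite uw we.
Qed.

(** The clauses have no literal of [u] of their own, so the added literal can be
    recognised and removed again. *)
Lemma or_lit_inj u e b1 b2 c1 c2 :
  u \notin e -> supports e c1 -> supports e c2 ->
  or_lit u b1 c1 = or_lit u b2 c2 -> b1 = b2 /\ c1 = c2.
Proof.
move=> ue e1 e2 /(congr1 (@nefset_val _))/= eq12.
have : lit b1 u \in lit b1 u |` nefset_val c1 by rewrite fset1U1.
rewrite eq12 in_fset1U (negPf (lit_notin_supported _ ue e2)) orbF.
move=> /eqP/lit_inj[b12 _]; split=> //.
apply: val_inj => /=.
rewrite -(fsetU1K (lit_notin_supported b1 ue e1)) eq12 b12 fsetU1K //.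
exact: lit_notin_supported ue e2.
Qed.

Lemma card_or_lit_image u b e (C : {fset clause V}) :
  u \notin e -> (forall c, c \in C -> supports e c) ->
  #|` [fset or_lit u b c | c in C]| = #|` C|.
Proof.
move=> ue C_supp; rewrite card_in_imfset //= => c1 c2 /C_supp e1 /C_supp e2.
by case/(or_lit_inj ue e1 e2).
Qed.

Lemma disjoint_or_lit_images u e (C D : {fset clause V}) :
  u \notin e -> (forall c, c \in C -> supports e c) ->
  (forall c, c \in D -> supports e c) ->
  [disjoint [fset or_lit u true c | c in C] & [fset or_lit u false c | c in D]].
Proof.
move=> ue C_supp D_supp; apply/fdisjointP => _ /imfsetP[c /= cC ->].
by apply/imfsetP => -[d /= dD /(or_lit_inj ue (C_supp c cC) (D_supp d dD))[]].
Qed.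

End Clauses.

(** * Eliminating a vertex *)

Section Elimination.
Variables (V : countType) (u : V).
Implicit Types (e : nefset V) (S : set (cnf V)).

(** Semantic form of the absence of [u]: it is all that the elimination of [u]
    needs to know about the rest of the graph. *)
Definition ignores S : Prop :=
  forall x, S x -> forall (a : assignment V) b,
    eval_cnf [eta a with u |-> b] x = eval_cnf a x.

Lemma edge_pow_ignores (e : {fset V}) n : u \notin e -> ignores (edge_pow e n).
Proof.
move=> ue x /edge_powP[_ x_supp] a b; apply: eq_in_all => c cx.
apply: eq_eval_clause (x_supp c cx) _ => w we /=.
by case: eqP => // wu; move: ue; rewrite -wu we.
Qed.

Lemma graph_cnfs_ignores (g : graph V) :
  (forall e : {fset V}, e \in graph_edges g -> u \notin e) ->
  ignores (graph_cnfs g).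
Proof.
move=> gu x [f [f_pow xE]] a b; apply: eq_in_all => c.
rewrite xE => /bigfcupP[e /andP[eg _] cf].
have := f_pow e eg => /edge_powP[_ /(_ c cf) ec].
apply: eq_eval_clause ec _ => w we /=; case: eqP => // wu.
by rewrite msuppE in eg; have := gu e eg; rewrite -wu we.
Qed.

Lemma iff_equisat (S1 S2 : set (cnf V)) :
  (totally_satisfiable S1 <-> totally_satisfiable S2) -> equisat S1 S2.
Proof.
by rewrite /equisat /unsatisfiable; case: (EM (totally_satisfiable S1)); tauto.
Qed.

(** For a conjunction, the assignment may depend on the pair of Cnfs chosen, and
    nonemptiness splits into the two factors. *)
Lemma totally_satisfiable_and (S T : set (cnf V)) :
  totally_satisfiable (set_and S T) <->
  [/\ (exists x, S x), (exists y, T y) &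
      forall x y, S x -> T y ->
        exists2 a, eval_cnf a x & eval_cnf a y].
Proof.
split=> [[[_ [x Sx [y Ty _]]] ST_sat]|[[x Sx] [y Ty] ST_sat]].
  split; [by exists x | by exists y | move=> x' y' Sx' Ty'].
  have [|a] := ST_sat (nefsetU x' y'); first by exists x' => //; exists y'.
  by rewrite eval_cnfU => /andP[]; exists a.
split; first by exists (nefsetU x y), x => //; exists y.
move=> _ [x' Sx' [y' Ty' <-]]; have [a ax ay] := ST_sat x' y' Sx' Ty'.
by exists a; rewrite eval_cnfU ax.
Qed.

(** The literal of [u] in the only clause can be made true independently of the
    assignment that satisfies the other factor. *)
Lemma edge_single_equisat S e :
  ignores S -> u \in nefset_val e ->
  equisat (set_and S (edge_pow e 1)) S.
Proof.
move=> Su ue; apply: iff_equisat; rewrite totally_satisfiable_and.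
have e1 : 0 < 1 <= 2 ^ #|` e| by rewrite expn_gt0.
have [y0 ey0] := edge_pow_inhabited e1.
split=> [[Sn0 _ ST]|[Sn0 S_sat]].
  by split=> // x Sx; have [a] := ST _ _ Sx ey0; exists a.
split=> // [|x y Sx /edge_powP[cardy y_supp]]; first by exists y0.
have /eqP/cardfs1P[c yE] := cardy.
have cy : c \in nefset_val y by rewrite yE fset11.
have [sgn cE] := y_supp c cy; have [a ax] := S_sat x Sx.
exists [eta a with u |-> sgn u]; first by rewrite Su.
apply/eval_cnfP => d; rewrite yE => /fset1P ->.
apply/eval_clauseP; exists (lit (sgn u) u); last by rewrite eval_lit /= !eqxx.
by rewrite cE; apply/imfsetP; exists u.
Qed.

Lemma edge_full_unsat S e n :
  2 ^ #|` e| <= n -> unsatisfiable (set_and S (edge_pow e n)).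
Proof.
move=> le_n /totally_satisfiable_and[[x Sx] [y Ty] /(_ x y Sx Ty)[a _ ay]].
by apply: edge_pow_full_unsat le_n Ty _; exists a.
Qed.

(** By pigeonhole, one sign [b] of [u] carries at most [n %/ 2] clauses.  Giving
    [u] the value [~~ b] settles all the others, and the hypothesis on [n %/ 2]
    clauses of [e] settles the remaining ones. *)
Lemma edge_half_sat S (e : nefset V) n :
  ignores S -> u \notin nefset_val e -> 1 < n <= 2 ^ #|` e|.+1 ->
  totally_satisfiable (set_and S (edge_pow e (n %/ 2))) ->
  totally_satisfiable (set_and S (edge_pow (u |` nefset_val e) n)).
Proof.
move=> Su ue /andP[n_gt1 le_n] /totally_satisfiable_and[Sn0 _ ST].
have m_gt0 : 0 < n %/ 2 by rewrite divn_gt0.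
have le_m : n %/ 2 <= 2 ^ #|` e| by exact: half_le_exp2.
apply/totally_satisfiable_and; split=> // [|x y Sx /edge_powP[cardy y_supp]].
  apply: (@edge_pow_inhabited _ (nefsetU (nefset1 u) e)).
  by rewrite (ltnW n_gt1) /= cardfsU1 ue.
pose P b := [fset c in clauses_on e | or_lit u b c \in nefset_val y].
have P_supp b c : c \in P b -> supports e c.
  by rewrite !inE => /andP[/clauses_onP].
have sP b : [fset or_lit u b c | c in P b] `<=` nefset_val y.
  apply/fsubsetP => c0 /imfsetP[c /= cP ->].
  by move: cP; rewrite !inE => /andP[].
have le_P : #|` P true| + #|` P false| <= n.
  rewrite -(card_or_lit_image true ue (@P_supp true)).
  rewrite -(card_or_lit_image false ue (@P_supp false)).
  have /eqP dis := disjoint_or_lit_images ue (@P_supp true) (@P_supp false).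
  rewrite -cardfsUI dis cardfs0 addn0 -cardy.
  by apply: fsubset_leq_card; rewrite fsubUset !sP.
have [b le_Pb] : exists b, #|` P b| <= n %/ 2.
  case: (leqP #|` P true| #|` P false|) => le_tf; [exists true | exists false];
  rewrite leq_divRL // muln2 -addnn; apply: leq_trans le_P.
    by rewrite leq_add2l.
  by rewrite leq_add2r ltnW.
(* [P b] may be too small for [ST], which is about exactly [n %/ 2] clauses. *)
have [||//|z ez sPz] := @edge_pow_between _ e (n %/ 2) (P b).
- by apply/fsubsetP => c /P_supp/clauses_onP.
- by rewrite le_Pb.
have [a ax az] := ST x z Sx ez.
(* [S], and likewise [z] below, does not see the change of value at [u]. *)
exists [eta a with u |-> ~~ b]; first by rewrite Su.
apply/eval_cnfP => c0 cy.
have [b' [c ec cE]] := supports_or_lit_inv ue (y_supp _ cy).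
subst c0; rewrite eval_or_lit /= eqxx.
have [b'E|] := eqVneq b' b; last by case: b' b {cy le_Pb sPz} => -[].
rewrite (_ : eval_clause _ c = true) ?orbT //.
have uz := edge_pow_ignores ue ez a (~~ b); rewrite az in uz.
move/eval_cnfP: uz; apply; apply: (fsubsetP sPz).
by rewrite !inE -b'E cy andbT; apply/clauses_onP.
Qed.

(** Each clause [c] on [e] is the resolvent of its two extensions by [u]: an
    assignment satisfying both satisfies [c]. *)
Lemma edge_double_sat S (e : nefset V) n :
  u \notin nefset_val e -> 1 < n <= 2 ^ #|` e|.+1 ->
  totally_satisfiable (set_and S (edge_pow (u |` nefset_val e) n)) ->
  totally_satisfiable (set_and S (edge_pow e (n %/ 2))).
Proof.
move=> ue /andP[n_gt1 le_n] /totally_satisfiable_and[Sn0 _ ST].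
have m_gt0 : 0 < n %/ 2 by rewrite divn_gt0.
have le_m : n %/ 2 <= 2 ^ #|` e| by exact: half_le_exp2.
apply/totally_satisfiable_and; split=> // [|x y Sx /edge_powP[cardy y_supp]].
  by apply: edge_pow_inhabited; rewrite m_gt0.
pose D := [fset or_lit u true c | c in nefset_val y] `|`
          [fset or_lit u false c | c in nefset_val y].
(* For odd [n] one more clause completes [D], whose size is [2 * (n %/ 2)]. *)
have [||/=|z ez sDz] := @edge_pow_between _ (nefsetU (nefset1 u) e) n D.
- apply/fsubsetP => c; rewrite in_fsetU => cD; apply/clauses_onP.
  by case/orP: cD => /imfsetP[d /= /y_supp ed ->]; apply: supports_or_lit.
- rewrite /= cardfsU1 ue le_n andbT.
  rewrite /D; have /eqP dis := disjoint_or_lit_images ue y_supp y_supp.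
  rewrite -[X in X <= _]addn0 -(cardfs0 (clause V)) -dis cardfsUI.
  by rewrite !(card_or_lit_image _ ue y_supp) cardy addnn -muln2 leq_divM.
- exact: ltnW.
have [a ax /eval_cnfP az] := ST x z Sx ez.
exists a => //; apply/eval_cnfP => c cy.
have or_litD b : or_lit u b c \in nefset_val z.
  apply: (fsubsetP sDz); rewrite in_fsetU; apply/orP.
  by case: b; [left | right]; apply/imfsetP; exists c.
(* The extension whose literal of [u] is false under [a] leaves only [c]. *)
by have := az _ (or_litD (~~ a u)); rewrite eval_or_lit; case: (a u).
Qed.

End Elimination.

(** * The edges of the statement *)

Section EdgeFromTo.
Variables (V : countType) (v : nat -> V).

Lemma in_edge_from_to i j w :
  reflect (exists2 l, i <= l <= j & w = v l) (w \in edge_from_to v i j).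
Proof.
rewrite inE; apply: (iffP mapP) => -[l lij ->]; exists l => //;
  by move: lij; rewrite mem_index_iota ltnS.
Qed.

Lemma edge_from_to_recl i j :
  i <= j -> edge_from_to v i j = v i |` edge_from_to v i.+1 j.
Proof.
move=> le_ij; apply/fsetP => w; rewrite in_fset1U.
by rewrite !inE /index_iota subSn //= subSS inE.
Qed.

Lemma card_edge_from_to i j :
  {in [pred l | i <= l <= j] &, injective v} ->
  #|` edge_from_to v i j| = j.+1 - i.
Proof.
move=> v_inj; rewrite card_fseq undup_id ?size_map ?size_iota //.
rewrite map_inj_in_uniq ?iota_uniq // => l m.
by rewrite !mem_index_iota !ltnS; apply: v_inj.
Qed.

End EdgeFromTo.

Theorem proposition4p2 (V : countType) (k : nat) (hk : (1 <= k)%N)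
    (v : nat -> V) (v_inj : {in [pred i | (1 <= i <= k)%N] &, injective v})
    (s : graph V)
    (hs : forall e : {fset V}, e \in graph_edges s -> v 1%N \notin e)
    (n : nat) :
  [/\ equisat (set_and (graph_cnfs s) (edge_pow (edge_from_to v 1 k) 1))
              (graph_cnfs s),
      (1 < n < 2 ^ k)%N ->
      equisat (set_and (graph_cnfs s) (edge_pow (edge_from_to v 1 k) n))
              (set_and (graph_cnfs s) (edge_pow (edge_from_to v 2 k) (n %/ 2)))
    & (2 ^ k <= n)%N ->
      equisat (set_and (graph_cnfs s) (edge_pow (edge_from_to v 1 k) n))
              (set1 (cnf_bot V))].
Proof.
have su := graph_cnfs_ignores hs.
have cardE : #|` edge_from_to v 1 k| = k by rewrite card_edge_from_to // subn1.
have E0 : edge_from_to v 1 k != fset0 by rewrite -cardfs_gt0 cardE.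
pose E := NEFset E0.
have v1E : v 1 \in nefset_val E by apply/in_edge_from_to; exists 1.
split=> [|/andP[n_gt1 n_lt]|n_ge].
- exact: edge_single_equisat su v1E.
- (* For [k = 1] no [n] is in range, so that the edge 2...k is nonempty here. *)
  have k_gt1 : 1 < k.
    by rewrite -(ltn_exp2l 1 k (erefl (1 < 2))) expn1 (leq_ltn_trans n_gt1).
  have v1E' : v 1 \notin edge_from_to v 2 k.
    apply/in_edge_from_to => -[l /andP[l_gt1 l_le] v1l].
    have l1 : 1 = l by apply: v_inj => //; rewrite inE ?hk // (ltnW l_gt1).
    by rewrite -l1 in l_gt1.
  have E'0 : edge_from_to v 2 k != fset0.
    by apply/fset0Pn; exists (v 2); apply/in_edge_from_to; exists 2.
  pose E' := NEFset E'0.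
  have cardE' : #|` E'|.+1 = k.
    by rewrite -cardE edge_from_to_recl // cardfsU1 v1E'.
  have n_le : 1 < n <= 2 ^ #|` E'|.+1 by rewrite cardE' n_gt1 ltnW.
  rewrite edge_from_to_recl //; apply: iff_equisat; split.
    exact: (@edge_double_sat _ _ _ E').
  exact: (@edge_half_sat _ _ _ E').
- right; split; first by apply: (@edge_full_unsat _ _ E); rewrite /= cardE.
  case=> _ /(_ _ (erefl _))[a /eval_cnfP/(_ (nefset1 (Bot V)))].
  rewrite /= in_fset1 eqxx => /(_ isT)/eval_clauseP[l].
  by rewrite /= in_fset1 => /eqP->.
Qed.
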